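(* Let $n,r\ge 1$. There is an isomorphism of $\mathbb{C}$-algebras $$\mathbb{C}[\mathrm{SL}(n,\mathbb{C})^{\times r}/\!\!/\mathrm{SL}(n,\mathbb{C})]\cong \mathbb{C}[\mathfrak{gl}(n,\mathbb{C})^{\times r}/\!\!/\mathrm{GL}(n,\mathbb{C})]/\mathfrak{I},$$ where $\mathfrak{I}=\left(\mathrm{tr}(\mathbf{X}_1^n)-P(\mathbf{X}_1),\dots,\mathrm{tr}(\mathbf{X}_r^n)-P(\mathbf{X}_r)\right)$ and $$P(\mathbf{X})=\mathrm{tr}(\mathbf{X}^n)+(-1)^n n(\det(\mathbf{X})-1)=(-1)^{n+1}n+\sum_{k=1}^{n-1}(-1)^{n+k+1}C_0^{n-k}(\mathbf{X})\,\mathrm{tr}(\mathbf{X}^k)$$ is a polynomial in terms of the coefficients of the characteristic polynomial. Here the coefficients $C_0^m(\mathbf{X})$ may be computed recursively using $C_0^0(\mathbf{X})=1$, $C_0^1(\mathbf{X})=\mathrm{tr}(\mathbf{X})$, and $$C_0^m(\mathbf{X})=\frac{1}{m}\sum_{k=1}^m(-1)^{k+1}C_0^{m-k}(\mathbf{X})\,\mathrm{tr}(\mathbf{X}^k)\qquad (m\geq 1).$$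
   Context: For $Y=\mathrm{SL}(n,\mathbb{C})^{\times r}$ or $Y=\mathfrak{gl}(n,\mathbb{C})^{\times r}$ (all $r$-tuples of $n\times n$ complex matrices), the groups $\mathrm{SL}(n,\mathbb{C})$ and $\mathrm{GL}(n,\mathbb{C})$ act by simultaneous conjugation $g\cdot(A_1,\dots,A_r)=(gA_1g^{-1},\dots,gA_rg^{-1})$, and for $G$ either group $\mathbb{C}[Y/\!\!/G]=\mathbb{C}[Y]^{G}$ is the ring of invariant polynomial functions on $Y$. $\mathbf{X}_k=(x_{ij}^k)$, $1\le k\le r$, are the generic $n\times n$ matrices whose entries are the coordinate functions of $\mathfrak{gl}(n,\mathbb{C})^{\times r}$. The coefficients of the characteristic polynomial of an $n\times n$ matrix $\mathbf{X}$ are the functions $C^n_k$ defined by $\det(t\mathbf{I}-\mathbf{X})=\sum_{k=0}^n(-1)^{n-k}C^n_k(\mathbf{X})t^k$. One has $C_0^n(\mathbf{X})=\det(\mathbf{X})$ for $n\times n$ matrices, and for $0\le m\le n$ the notation $C_0^m(\mathbf{X})$ on $n\times n$ matrices denotes $C^n_{n-m}(\mathbf{X})$, i.e. the $m$-th elementary symmetric function of the eigenvalues of $\mathbf{X}$. *)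

(* Defs.v *)
From HB Require Import structures.
From mathcomp Require Import all_boot all_order all_algebra.
From mathcomp Require Import boolp classical_sets functions reals.
From mathcomp Require Import mpoly complex.

Set Implicit Arguments.
Unset Strict Implicit.
Unset Printing Implicit Defensive.

Import GRing.Theory.
Local Open Scope ring_scope.
Local Open Scope quotient_scope.

(* The constructions are over a field F; the complex numbers are F = R[i] for
   a realType R. *)

(* The coordinates x_ij^k (A) = A k i j of an r-tuple of matrices, indexed by
   an enumeration of the triples (k, i, j). *)
Definition coords (F : fieldType) (n r : nat) (A : 'I_r -> 'M[F]_n) :
    'I_#|{: 'I_r * 'I_n * 'I_n}| -> F :=
  fun a => let: (k, i, j) := enum_val a in A k i j.

Section CoordinateRing.
Variables (F : fieldType) (n r : nat).
Variables (Y : pointedType) (iota : Y -> 'I_r -> 'M[F]_n).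

(* Polynomial functions on Y, viewed inside gl(n, F)^r via iota: restrictions
   of polynomials in the matrix entries.  F^o is F as a module over itself. *)
Definition polyfun_pred : {pred Y -> F^o} :=
  fun f => `[< exists p : {mpoly F[#|{: 'I_r * 'I_n * 'I_n}|]},
                 forall y, f y = p.@[coords (iota y)] >].

Lemma polyfun_subring : subring_closed polyfun_pred.
Proof.
split=> [|f g /asboolP[p fp] /asboolP[q gq]|f g /asboolP[p fp] /asboolP[q gq]].
- by apply/asboolP; exists 1 => y; rewrite meval1.
- by apply/asboolP; exists (p - q) => y; rewrite mevalB -fp -gq.
- by apply/asboolP; exists (p * q) => y; rewrite mevalM -fp -gq.
Qed.

HB.instance Definition _ :=
  GRing.isSubringClosed.Build (Y -> F^o) polyfun_pred polyfun_subring.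

Lemma polyfun_scaler : GRing.scaler_closed polyfun_pred.
Proof.
move=> a f /asboolP[p fp]; apply/asboolP; exists (a *: p) => y.
by rewrite mevalZ -fp.
Qed.

HB.instance Definition _ :=
  GRing.isScaleClosed.Build F (Y -> F^o) polyfun_pred polyfun_scaler.

(* The coordinate ring F[Y]. *)
Record coord_ring :=
  CoordRing { cfun :> Y -> F^o; cfunP : cfun \in polyfun_pred }.

HB.instance Definition _ := [isSub for cfun].
HB.instance Definition _ := [Choice of coord_ring by <:].
HB.instance Definition _ := [SubChoice_isSubComNzRing of coord_ring by <:].
HB.instance Definition _ := [SubZmodule_isSubLmodule of coord_ring by <:].

Lemma coord_ring_scalerAl (a : F) (f g : coord_ring) :
  a *: (f * g) = (a *: f) * g.
Proof.
apply: val_inj; apply: funext => y.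
exact: (mulrA a (cfun f y : F) (cfun g y : F)).
Qed.

HB.instance Definition _ :=
  GRing.Lmodule_isLalgebra.Build F coord_ring coord_ring_scalerAl.
HB.instance Definition _ := GRing.Lalgebra_isComAlgebra.Build F coord_ring.

End CoordinateRing.

Section InvariantRing.
Variables (F : fieldType) (n r : nat).
Variables (Y : pointedType) (iota : Y -> 'I_r -> 'M[F]_n).
Variables (G : Type) (act : G -> Y -> Y).

Definition invariant_pred : {pred coord_ring iota} :=
  fun f => `[< forall g y, f (act g y) = f y >].

Lemma invariant_subring : subring_closed invariant_pred.
Proof.
split=> [|f h /asboolP fP /asboolP hP|f h /asboolP fP /asboolP hP];
  apply/asboolP => g y //.
- by rewrite -[LHS]/(f (act g y) - h (act g y)) fP hP.
- by rewrite -[LHS]/(f (act g y) * h (act g y)) fP hP.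
Qed.

HB.instance Definition _ := GRing.isSubringClosed.Build
  (coord_ring iota) invariant_pred invariant_subring.

Lemma invariant_scaler : GRing.scaler_closed invariant_pred.
Proof.
move=> a f /asboolP fP; apply/asboolP => g y.
by rewrite -[LHS]/(a *: f (act g y)) fP.
Qed.

HB.instance Definition _ := GRing.isScaleClosed.Build F
  (coord_ring iota) invariant_pred invariant_scaler.

(* The invariant ring F[Y]^G = F[Y // G]. *)
Record invariant_ring :=
  InvariantRing { inv_fun :> coord_ring iota;
                  inv_funP : inv_fun \in invariant_pred }.

HB.instance Definition _ := [isSub for inv_fun].
HB.instance Definition _ := [Choice of invariant_ring by <:].
HB.instance Definition _ := [SubChoice_isSubComNzRing of invariant_ring by <:].
HB.instance Definition _ := [SubZmodule_isSubLmodule of invariant_ring by <:].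

Lemma invariant_ring_scalerAl (a : F) (f g : invariant_ring) :
  a *: (f * g) = (a *: f) * g.
Proof. by apply/val_inj; exact: scalerAl. Qed.

HB.instance Definition _ :=
  GRing.Lmodule_isLalgebra.Build F invariant_ring invariant_ring_scalerAl.
HB.instance Definition _ := GRing.Lalgebra_isComAlgebra.Build F invariant_ring.

End InvariantRing.

(* The library quotient of a commutative ring by a proper ideal is only a ring;
   when the ring is an algebra, the quotient is one for the scaling
   a *: [x] = [a *: x]. *)
Section QuotientAlgebra.
Variables (F : pzRingType) (A : comAlgType F) (I : idealr A).
Local Notation Q := {ideal_quot I}.

Definition quot_scale (a : F) (q : Q) : Q := \pi_Q (a *: repr q).

Lemma pi_scale (a : F) (x : A) : \pi_Q (a *: x) = quot_scale a (\pi_Q x).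
Proof.
apply/eqP; rewrite /quot_scale -Quotient.idealrBE -scalerBr -mulr_algl.
by apply: idealMr; rewrite Quotient.idealrBE reprK.
Qed.

Lemma quot_scalerA a b (q : Q) :
  quot_scale a (quot_scale b q) = quot_scale (a * b) q.
Proof.
by move: q; apply: quotW => x; rewrite -(pi_scale b x) -!pi_scale scalerA.
Qed.

Lemma quot_scale1r : left_id 1 quot_scale.
Proof. by apply: quotW => x; rewrite -pi_scale scale1r. Qed.

Lemma quot_scalerDr : right_distributive quot_scale +%R.
Proof.
move=> a; apply: quotW => x; apply: quotW => y.
by rewrite -rmorphD -!pi_scale scalerDr rmorphD.
Qed.

Lemma quot_scalerDl (q : Q) : {morph quot_scale^~ q : a b / a + b}.
Proof.
by move: q; apply: quotW => x a b; rewrite -!pi_scale scalerDl rmorphD.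
Qed.

HB.instance Definition _ := GRing.Zmodule_isLmodule.Build F Q
  quot_scalerA quot_scale1r quot_scalerDr quot_scalerDl.

Lemma quot_scalerAl (a : F) (p q : Q) : a *: (p * q) = (a *: p) * q.
Proof.
move: p q; apply: quotW => x; apply: quotW => y.
rewrite -rmorphM -[LHS]pi_scale -[X in _ = X * _]pi_scale.
by rewrite -rmorphM scalerAl.
Qed.

HB.instance Definition _ := GRing.Lmodule_isLalgebra.Build F Q quot_scalerAl.
HB.instance Definition _ := GRing.Lalgebra_isComAlgebra.Build F Q.

End QuotientAlgebra.

(* Membership in the ideal generated by the family g. *)
Definition ideal_gen (A : comNzRingType) (r : nat) (g : 'I_r -> A) : {pred A} :=
  fun x => `[< exists c : 'I_r -> A, x = \sum_k c k * g k >].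

Section Groups.
Variables (F : fieldType) (n r : nat).

Record GL := MkGL { gl_mx :> 'M[F]_n; gl_mxP : gl_mx \in unitmx }.
Record SL := MkSL { sl_mx :> 'M[F]_n; sl_mxP : \det sl_mx = 1 }.

Definition glr : Type := 'I_r -> 'M[F]_n.
Definition slr : Type := 'I_r -> SL.

HB.instance Definition _ := gen_eqMixin SL.
HB.instance Definition _ := gen_choiceMixin SL.
HB.instance Definition _ := Choice.on glr.
HB.instance Definition _ := Choice.on slr.
HB.instance Definition _ := isPointed.Build glr (fun=> 1%:M).
HB.instance Definition _ := isPointed.Build slr (fun=> MkSL (det1 F n)).

Definition glr_mx (A : glr) : 'I_r -> 'M[F]_n := A.
Definition slr_mx (A : slr) : 'I_r -> 'M[F]_n := fun k => A k.

Definition gl_conj (g : GL) (A : glr) : glr :=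
  fun k => g *m A k *m invmx g.

Lemma sl_conjP (g A : SL) : \det (g *m A *m invmx g) = 1.
Proof. by rewrite !det_mulmx det_inv !sl_mxP invr1 !mulr1. Qed.

Definition sl_conj (g : SL) (A : slr) : slr := fun k => MkSL (sl_conjP g (A k)).

(* F[gl(n, F)^r // GL(n, F)] and F[SL(n, F)^r // SL(n, F)]. *)
Definition gl_inv : Type := invariant_ring glr_mx gl_conj.
Definition sl_inv : Type := invariant_ring slr_mx sl_conj.

HB.instance Definition _ := GRing.ComAlgebra.on gl_inv.
HB.instance Definition _ := GRing.ComAlgebra.on sl_inv.

End Groups.

Section CharCoef.
Variables (A : comNzRingType) (n : nat) (X : 'M[A]_n).

(* C^n_k, where det(tI - X) = \sum_(k <= n) (-1)^(n-k) C^n_k(X) t^k. *)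
Definition Ccoef (k : nat) : A := (-1) ^+ (n - k) * (char_poly X)`_k.

(* C_0^m(X) := C^n_(n-m)(X); meaningful for m <= n only. *)
Definition C0 (m : nat) : A := Ccoef (n - m).

Definition Ppoly : A :=
  \tr (X ^+ n) + (-1) ^+ n * n%:R * (\det X - 1).

End CharCoef.

Section Generators.
Variables (F : fieldType) (n r : nat).

Local Notation Fgl := (coord_ring (@glr_mx F n r)).

Lemma coord_fun_subproof (k : 'I_r) (i j : 'I_n) :
  (fun A : glr F n r => A k i j : F^o) \in polyfun_pred (@glr_mx F n r).
Proof.
apply/asboolP; exists 'X_(enum_rank (k, i, j)) => A.
by rewrite mevalXU /coords enum_rankK.
Qed.

Definition coord_fun (k : 'I_r) (i j : 'I_n) : Fgl :=
  CoordRing (coord_fun_subproof k i j).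

Definition generic_mx (k : 'I_r) : 'M[Fgl]_n := \matrix_(i, j) coord_fun k i j.

Definition eval_at (A : glr F n r) (f : Fgl) : F := f A.

Fact eval_at_zmod_morphism A : zmod_morphism (eval_at A).
Proof. by []. Qed.

Fact eval_at_monoid_morphism A : monoid_morphism (eval_at A).
Proof. by []. Qed.

HB.instance Definition _ A := GRing.isZmodMorphism.Build Fgl F (eval_at A)
  (eval_at_zmod_morphism A).
HB.instance Definition _ A := GRing.isMonoidMorphism.Build Fgl F (eval_at A)
  (eval_at_monoid_morphism A).

Lemma eval_generic_mx A k : map_mx (eval_at A) (generic_mx k) = A k.
Proof. by apply/matrixP => i j; rewrite !mxE. Qed.

Definition rel_fun (k : 'I_r) : Fgl :=
  \tr (generic_mx k ^+ n) - Ppoly (generic_mx k).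

Lemma eval_rel_fun A k :
  eval_at A (rel_fun k) = - ((-1) ^+ n * n%:R * (\det (A k) - 1)).
Proof.
rewrite /rel_fun /Ppoly opprD addNKr rmorphN !rmorphM rmorphB rmorph1.
by rewrite rmorph_sign rmorph_nat -det_map_mx eval_generic_mx.
Qed.

Lemma rel_funP k : rel_fun k \in invariant_pred (@gl_conj F n r).
Proof.
apply/asboolP => g A; rewrite -[LHS]/(eval_at _ _) -[RHS]/(eval_at _ _).
rewrite !eval_rel_fun; congr (- (_ * (_ - 1))).
rewrite /gl_conj !det_mulmx det_inv mulrAC divrr ?mul1r //.
by rewrite -unitmxE gl_mxP.
Qed.

(* tr(X_k^n) - P(X_k), as an element of the ring of invariants. *)
Definition rel_gen (k : 'I_r) : gl_inv F n r := InvariantRing (rel_funP k).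

Definition rel_ideal : {pred gl_inv F n r} := ideal_gen rel_gen.

Lemma rel_ideal_closed : idealr_closed rel_ideal.
Proof.
split.
- by apply/asboolP; exists (fun=> 0); rewrite big1 // => k _; rewrite mul0r.
- apply/asboolP => -[c].
  pose ev : {rmorphism gl_inv F n r -> F} := eval_at (fun=> 1%:M) \o val.
  have ev0 k : ev (rel_gen k) = 0.
    by rewrite [LHS]eval_rel_fun det1 subrr mulr0 oppr0.
  move=> /(congr1 ev)/eqP; rewrite rmorph1 rmorph_sum big1 ?oner_eq0 // => k _.
  by rewrite rmorphM ev0 mulr0.
- move=> a _ _ /asboolP[c ->] /asboolP[d ->]; apply/asboolP.
  exists (fun k => a * c k + d k); rewrite mulr_sumr -big_split /=.
  by apply: eq_bigr => k _; rewrite mulrDl mulrA.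
Qed.

HB.instance Definition _ :=
  isIdealr.Build (gl_inv F n r) rel_ideal rel_ideal_closed.

End Generators.

(* Main.v *)
(* A polynomial function on gl_n^r splits into components homogeneous in the
   k-th matrix.  Multiplying the component of degree d by
   det(X_k)^floor((D - d) / n), with D larger than all degrees, changes the
   function by a multiple of det(X_k) - 1, compatibly with conjugation, and
   brings all degrees in X_k into a window of n consecutive integers.  A function
   with such degrees that vanishes where det(X_k) = 1 is zero: along a line
   z |-> zB with det(B) = 1 it is a power of z times a polynomial of degree < n
   with the n-th roots of unity among its zeros, so it vanishes wherever X_k is
   invertible, hence everywhere.  Normalizing f in each of the r matrices gives
   f' = f + \sum_k c_k (det(X_k) - 1) such that any relation f' = 0 or
   f'(g A) = f'(A) valid on SL_n^r is valid on gl_n^r.  Applied to invariants,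
   this computes the kernel of the restriction to SL_n^r; applied to arbitrary
   extensions of invariants of SL_n^r, it shows that the restriction is
   surjective.  The trace formulas are Newton's identities, which follow from
   char_poly^`() = \tr (\adj (t I - X)). *)
Require Import Defs.
From HB Require Import structures.
From mathcomp Require Import all_boot all_order all_algebra.
From mathcomp Require Import boolp classical_sets functions reals.
From mathcomp Require Import perm mpoly complex.

Set Implicit Arguments.
Unset Strict Implicit.
Unset Printing Implicit Defensive.

Import GRing.Theory Num.Theory.
Local Open Scope ring_scope.

(** * Derivative of a determinant and Newton's identities *)

Lemma deriv_prod (R : comNzRingType) (I : finType) (F : I -> {poly R}) :
  (\prod_i F i)^`() = \sum_i (F i)^`() * \prod_(j | j != i) F j.
Proof.
elim: (index_enum I) (index_enum_uniq I) => [_|x s IHs].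
  by rewrite !big_nil derivC.
move=> /= /andP[xs us]; rewrite !big_cons derivM IHs // eqxx; congr (_ * _ + _).
  rewrite [RHS]big_seq_cond [LHS]big_seq_cond; apply: eq_bigl => j.
  by case: eqVneq => [->|]; rewrite ?(negPf xs) ?andbT.
rewrite mulr_sumr [LHS]big_seq [RHS]big_seq; apply: eq_bigr => i si.
rewrite big_cons; case: eqVneq si => [<-|_ _]; first by rewrite (negPf xs).
by rewrite mulrCA.
Qed.

(** Jacobi's formula: the product rule gives the sum of the [\det (N i)], where only row i is
    differentiated; expanding along that row yields the cofactors. *)
Lemma deriv_det (R : comNzRingType) n (M : 'M[{poly R}]_n) :
  (\det M)^`() = \tr (\adj M *m map_mx (@deriv R) M).
Proof.
pose N i : 'M[{poly R}]_n := \matrix_(k, j) if k == i then (M i j)^`() else M k j.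
transitivity (\sum_i \det (N i)).
  rewrite /determinant raddf_sum exchange_big; apply: eq_bigr => s _ /=.
  have -> p : ((-1) ^+ odd_perm s * p)^`() = (-1) ^+ odd_perm s * p^`().
    by rewrite !mulr_sign; case: (odd_perm s); rewrite ?derivN.
  rewrite deriv_prod mulr_sumr; apply: eq_bigr => i _.
  rewrite [in RHS](bigD1 i) //= !mxE eqxx.
  by congr (_ * (_ * _)); apply: eq_bigr => j /negPf ji; rewrite mxE ji.
rewrite mxtrace_mulC; apply: eq_bigr => i _; rewrite (expand_det_row _ i) mxE.
apply: eq_bigr => j _; rewrite !mxE eqxx; congr (_ * (_ * \det _)).
by apply/matrixP => k l; rewrite !mxE eq_sym (negPf (neq_lift _ _)).
Qed.

(** Comparing coefficients in adj(tI - X) (tI - X) = c(t) I gives a recursion that expresses the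
    traces of the coefficients of the adjugate through power traces. By Jacobi's formula c' =
    tr(adj), so these traces are also multiples of the coefficients of c. *)
Lemma newton_char_poly (A : comNzRingType) n (X : 'M[A]_n) m : (m <= n)%N ->
  m%:R * (char_poly X)`_(n - m) +
    \sum_(1 <= j < m.+1) (char_poly X)`_(n - m + j) * \tr (X ^+ j) = 0.
Proof.
move=> le_mn; set c := char_poly X; pose adjX := \adj (char_poly_mx X).
have sz_c : size c = n.+1 by rewrite size_char_poly.
have adjE : adjX *m char_poly_mx X = c%:M := mul_adj_mx _.
have dc : c^`() = \tr adjX.
  rewrite deriv_det -/adjX; congr (\tr _); rewrite -[RHS]mulmx1; congr (_ *m _).
  by apply/matrixP => i j; rewrite !mxE derivB derivC subr0 derivMn derivX.
clearbody c adjX.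
(* The factor t shifts indices so that the recursion [BS] also holds at d = 0, where [B 0]
   vanishes. *)
pose B d : 'M[A]_n := \matrix_(i, j) ('X * adjX i j)`_d.
have trB d : \tr (B d) = d%:R * c`_d.
  transitivity ('X * c^`())`_d.
    by rewrite dc mulr_sumr coef_sum; apply: eq_bigr => i _; rewrite mxE.
  by rewrite coefXM; case: d => [|d] /=; rewrite ?mul0r // coef_deriv mulr_natl.
have BS d : B d = B d.+1 *m X + (c`_d)%:M.
  apply/matrixP => i j.
  have := congr1 (fun M : 'M[{poly A}]_n => (M i j)`_d) adjE.
  rewrite !mxE => /esym.
  under eq_bigr => k _ do rewrite !mxE mulrBr mulrnAr mulrC.
  rewrite sumrB coefB !coef_sum (bigD1 j) //= eqxx mulr1n.
  rewrite big1 => [|k /negPf kj]; last by rewrite kj mulr0n coef0.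
  rewrite addr0 coefMn => ->.
  rewrite addrC -[LHS](subrK (\sum_k (adjX i k * (X k j)%:P)`_d)); congr (_ + _).
  by apply: eq_bigr => k _; rewrite !mxE coefMC coefXM.
have trBX d K : \tr (B d) =
    \sum_(i < K) c`_(d + i) * \tr (X ^+ i) + \tr (B (d + K)%N *m X ^+ K).
  elim: K => [|K IHK]; first by rewrite big_ord0 add0r addn0 expr0 mulmx1.
  rewrite IHK big_ord_recr /= -addrA; congr (_ + _).
  by rewrite BS mulmxDl -mulmxA mul_scalar_mx mxtraceD mxtraceZ addrC addnS exprS.
(* [K] exceeds m, so the sum can be cut after j = m, and it is at least the size of every entry, so
   the remainder vanishes. *)
pose K := (m.+1 + \max_i \max_j size ('X * adjX i j)%R)%N.
have B0 : B (n - m + K)%N = 0.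
  apply/matrixP => i j; rewrite !mxE nth_default // /K.
  apply: leq_trans (leq_trans (leq_addl _ _) (leq_addl _ _)).
  by apply: leq_trans (leq_bigmax i); apply: (leq_bigmax j).
have := trBX (n - m)%N K; rewrite B0 mul0mx mxtrace0 addr0 trB.
rewrite -(big_mkord xpredT (fun i => c`_(n - m + i) * \tr (X ^+ i))).
rewrite (big_cat_nat (n := m.+1)) //= ?leq_addr // [X in _ + X]big_nat_cond.
rewrite [X in _ + X]big1 => [|i /andP[/andP[mi _] _]].
  (* The term of exponent 0 is n c_(n-m); against (n-m) c_(n-m) it leaves m c_(n-m). *)
  rewrite addr0 big_ltn // addn0 expr0 mxtrace1 => E.
  apply: (addrI (c`_(n - m) * n%:R)); rewrite addr0 addrCA -E natrB // mulrBl.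
  by rewrite addrC subrK mulrC.
rewrite nth_default ?mul0r // sz_c -ltn_subLR ?subKn //.
exact: leq_subr.
Qed.

Section NewtonIdentities.
Variables (A : comNzRingType) (n : nat) (X : 'M[A]_n).

Lemma C0E m : (m <= n)%N -> C0 X m = (-1) ^+ m * (char_poly X)`_(n - m).
Proof. by move=> le_mn; rewrite /C0 /Ccoef subKn. Qed.

Lemma C0_0 : C0 X 0 = 1.
Proof.
rewrite C0E // subn0 mul1r.
by have /monicP := char_poly_monic X; rewrite lead_coefE size_char_poly.
Qed.

Lemma C0_det : C0 X n = \det X.
Proof. by rewrite C0E // subnn char_poly_det signrMK. Qed.

Lemma newton_C0 m : (m <= n)%N ->
  m%:R * C0 X m =
    \sum_(1 <= j < m.+1) (-1) ^+ (j + 1) * C0 X (m - j) * \tr (X ^+ j).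
Proof.
move=> le_mn; have /eqP := newton_char_poly X le_mn.
rewrite addr_eq0 => /eqP E; rewrite C0E // mulrCA E mulrN mulr_sumr -sumrN.
apply: eq_big_nat => j /andP[_]; rewrite ltnS => le_jm.
rewrite C0E ?(leq_trans (leq_subr _ _)) // subnBA // addnBAC // -mulNr mulrA.
congr (_ * _); rewrite mulrA; congr (_ * _).
by rewrite -exprD addn1 addSn subnKC // exprS mulN1r.
Qed.

Lemma C0_1 : (0 < n)%N -> C0 X 1 = \tr X.
Proof.
move=> n0; rewrite -[LHS]mul1r (newton_C0 n0) big_nat1 C0_0 mulr1.
by rewrite expr2 mulN1r opprK mul1r.
Qed.

(** In Newton's identity for m = n, multiplied by (-1)^n, the last summand is -tr(X^n) and cancels
    the trace in P. *)
Lemma PpolyE : (0 < n)%N ->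
  Ppoly X = (-1) ^+ n.+1 * n%:R
     + \sum_(1 <= j < n) (-1) ^+ (n + j + 1) * C0 X (n - j) * \tr (X ^+ j).
Proof.
move=> n0; have := newton_C0 (leqnn n); rewrite C0_det big_nat_recr //= subnn C0_0.
rewrite /Ppoly mulr1 mulrBr mulr1 exprS mulN1r mulNr.
move=> /(congr1 ( *%R ((-1) ^+ n))).
rewrite mulrA mulrDr addn1 exprS mulN1r mulNr mulrN signrMK => ->.
rewrite addrA [\tr _ + _]addrC subrK addrC mulr_sumr; congr (_ + _).
by apply: eq_bigr => j _; rewrite !mulrA -addnA [in RHS]exprD.
Qed.
End NewtonIdentities.

(** * Power traces and P as polynomials in the characteristic coefficients *)

Section CoefficientPolynomials.
Variables (F : fieldType) (A : comAlgType F) (n : nat).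
Variables (I : Type) (X : I -> 'M[A]_n).

(** [Q] is chosen before [k]: one polynomial serves the whole family of matrices. *)
Let rep (x : I -> A) :=
  exists Q : {mpoly F[n.+1]},
    forall k, x k = mmap (in_alg A) (fun j : 'I_n.+1 => Ccoef (X k) j) Q.

Let repC a : rep (fun=> a%:A).
Proof. by exists a%:MP => k; rewrite mmapC. Qed.

Let repD x y : rep x -> rep y -> rep (fun k => x k + y k).
Proof. by move=> [P xP] [Q yQ]; exists (P + Q) => k; rewrite mmapD xP yQ. Qed.

Let repM x y : rep x -> rep y -> rep (fun k => x k * y k).
Proof. by move=> [P xP] [Q yQ]; exists (P * Q) => k; rewrite rmorphM xP yQ. Qed.

Let rep_int (z : int) : rep (fun=> z%:~R).
Proof. by have [Q zQ] := repC z%:~R; exists Q => k; rewrite -zQ scaler_int. Qed.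

Let rep_sum m1 m2 (x : nat -> I -> A) :
  (forall j, (m1 <= j < m2)%N -> rep (x j)) ->
  rep (fun k => \sum_(m1 <= j < m2) x j k).
Proof.
elim: m2 => [|m2 IHm] x_rep.
  by have [Q zQ] := rep_int 0; exists Q => k; rewrite -zQ big_geq.
have [le_m|lt_m] := leqP m1 m2; last first.
  by have [Q zQ] := rep_int 0; exists Q => k; rewrite -zQ big_geq.
have [Q xQ] : rep (fun k => \sum_(m1 <= j < m2) x j k + x m2 k).
  apply: repD; last by apply: x_rep; rewrite le_m ltnS leqnn.
  by apply: IHm => j /andP[m1j jm]; apply: x_rep; rewrite m1j ltnW.
by exists Q => k; rewrite -xQ big_nat_recr.
Qed.

Let rep_C0 m : rep (fun k => C0 (X k) m).
Proof.
exists 'X_(inord (n - m)) => k.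
by rewrite mmapX mmap1U inordK // ltnS leq_subr.
Qed.

(** Newton's identity is solved for its last power trace, whose coefficient is a sign, so the strong
    induction involves no division. *)
Lemma mxtrace_exp_Ccoef m : (m <= n)%N -> rep (fun k => \tr (X k ^+ m)).
Proof.
elim/ltn_ind: m => -[|m] IHm le_mn.
  have [Q nQ] := rep_int n; exists Q => k; rewrite -nQ.
  by rewrite expr0 mxtrace1.
have [Q xQ] : rep (fun k =>
    ((-1) ^+ m : int)%:~R * ((m.+1 : int)%:~R * C0 (X k) m.+1 + (-1 : int)%:~R *
      \sum_(1 <= j < m.+1)
         ((-1) ^+ (j + 1) : int)%:~R * C0 (X k) (m.+1 - j) * \tr (X k ^+ j))).
  apply: repM => //; apply: repD; first exact: repM.
  apply: repM => //; apply: rep_sum => j /andP[_ jm].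
  apply: repM; first exact: repM.
  by apply: IHm => //; apply: leq_trans le_mn; apply: ltnW.
exists Q => k; rewrite -xQ; have := newton_C0 (X k) le_mn.
rewrite big_nat_recr //= subnn C0_0 mulr1 => ->.
rewrite rmorph_sign rmorphN1 mulN1r.
under [X in _ - X]eq_bigr do rewrite rmorph_sign.
by rewrite addrAC subrr add0r addn1 !exprS !mulN1r opprK signrMK.
Qed.

Lemma Ppoly_Ccoef : (0 < n)%N -> rep (fun k => Ppoly (X k)).
Proof.
move=> n0; have [Q xQ] : rep (fun k => ((-1) ^+ n.+1 * n%:Z)%:~R
    + \sum_(1 <= j < n)
        ((-1) ^+ (n + j + 1) : int)%:~R * C0 (X k) (n - j) * \tr (X k ^+ j)).
  apply: repD => //; apply: rep_sum => j /andP[_ /ltnW jn].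
  by apply: repM (mxtrace_exp_Ccoef jn); apply: repM.
exists Q => k; rewrite -xQ PpolyE // rmorphM rmorph_sign; congr (_ + _).
by under [RHS]eq_bigr do rewrite rmorph_sign.
Qed.
End CoefficientPolynomials.

(** * Polynomials with many zeros *)

Lemma poly_fun_eq0 (F : numFieldType) (p : {poly F}) :
  (forall x, p.[x] = 0) -> p = 0.
Proof.
move=> p0; apply: (@roots_geq_poly_eq0 _ _ [seq i%:R | i <- iota 0 (size p)]).
- by apply/allP => x _; rewrite /root p0.
- by rewrite map_inj_uniq ?iota_uniq //; apply: mulrIn; rewrite oner_eq0.
- by rewrite size_map size_iota.
Qed.

Lemma poly_fun_inj (F : numFieldType) (p q : {poly F}) :
  (forall x, p.[x] = q.[x]) -> p = q.
Proof.
by move=> pq; apply/subr0_eq/poly_fun_eq0 => x; rewrite hornerD hornerN pq subrr.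
Qed.

(** The derivative of (X - x) P is P(x) at x, and (y - x) P'(y) at a root y of P: the first shows
    that x does not recur, the second passes simplicity to the tail. *)
Lemma uniq_simple_roots (F : fieldType) (s : seq F) :
  (forall x, x \in s -> ~~ root (\prod_(z <- s) ('X - z%:P))^`() x) -> uniq s.
Proof.
elim: s => //= x s IHs simple.
have dE y : (\prod_(z <- x :: s) ('X - z%:P))^`().[y] =
    (\prod_(z <- s) ('X - z%:P)).[y] +
    (y - x) * (\prod_(z <- s) ('X - z%:P))^`().[y].
  by rewrite big_cons derivM derivXsubC mul1r hornerD hornerM hornerXsubC.
apply/andP; split.
  have := simple x (mem_head _ _).
  by rewrite rootE dE subrr mul0r addr0 -rootE root_prod_XsubC.
apply: IHs => y sy; have := simple y; rewrite inE sy orbT => /(_ isT).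
have /eqP y0 : root (\prod_(z <- s) ('X - z%:P)) y by rewrite root_prod_XsubC.
by rewrite rootE dE y0 add0r mulf_eq0 negb_or => /andP[].
Qed.

(** The polynomial X^n - 1 splits, and its derivative n z^(n-1) is nonzero at its roots, so there
    are n distinct ones, more than the degree of [p] allows. *)
Lemma unity_roots_eq0 (F : numClosedFieldType) (n : nat) (p : {poly F}) :
  (0 < n)%N -> (size p <= n)%N ->
  (forall z, z ^+ n = 1 -> p.[z] = 0) -> p = 0.
Proof.
move=> n0 szp p0; have [s sE] := closed_field_poly_normal ('X^n - 1 : {poly F}).
rewrite (monicP (monicXnsubC _ n0)) scale1r in sE.
have sz : size s = n.
  by apply: succn_inj; rewrite -(size_prod_XsubC s id) -sE size_XnsubC.
have s_root z : z \in s -> z ^+ n = 1.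
  by rewrite -root_prod_XsubC -sE rootE !hornerE subr_eq0 => /eqP.
apply: (@roots_geq_poly_eq0 _ _ s); rewrite ?sz //.
  by apply/allP => z /s_root /p0 pz; apply/eqP.
apply: uniq_simple_roots => z /s_root zn; rewrite -sE rootE derivB derivC subr0.
rewrite derivXn hornerMn hornerXn mulrn_eq0 negb_or -lt0n n0 expf_neq0 //.
by rewrite -unitfE -(unitrX_pos _ n0) zn unitr1.
Qed.

(** * Homogeneous components in one matrix, and extension from determinant 1 *)

Section Rescaling.
Variables (F : numClosedFieldType) (n r : nat).
Local Notation Fgl := (coord_ring (@glr_mx F n r)).
Implicit Types (A : glr F n r) (f : Fgl) (k : 'I_r).

(** A polynomial representing [f] is evaluated at matrices over [S]; [ev] fixes scalars, so it
    commutes with this evaluation. With [S] a polynomial ring, [f] is seen to be polynomial along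
    one-parameter families. *)
Lemma coord_ring_eval (S : comNzRingType) (h : {rmorphism F -> S})
    (M : 'I_r -> 'M[S]_n) f :
  exists x : S, forall ev : {rmorphism S -> F}, cancel h ev ->
    f (fun j => map_mx ev (M j)) = ev x.
Proof.
have /asboolP[p fp] := cfunP f.
exists (mmap h (fun a => let: (k, i, j) := enum_val a in M k i j) p) => ev hK.
rewrite fp mevalE /mmap rmorph_sum; apply: eq_bigr => m _.
rewrite rmorphM hK /mmap1 rmorph_prod; congr (_ * _); apply: eq_bigr => a _.
rewrite rmorphXn /coords; congr (_ ^+ _).
by case: (enum_val a) => [[k i] j]; rewrite /glr_mx mxE.
Qed.

Definition scale_at k (l : F) A : glr F n r :=
  fun j => if j == k then l *: A j else A j.

Definition shift_at k (t : F) A : glr F n r :=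
  fun j => if j == k then A j + t%:M else A j.

Lemma shift_at_poly k A f :
  exists u : {poly F}, forall t, f (shift_at k t A) = u.[t].
Proof.
have [u uP] := coord_ring_eval (@polyC F)
  (fun j => map_mx polyC (A j) + if j == k then 'X%:M else 0) f.
exists u => t; rewrite -[u.[t]]/(horner_eval t u) -uP; last first.
  by move=> c; rewrite /= /horner_eval hornerC.
congr (cfun f _); apply: funext => j; apply/matrixP => i l.
rewrite /shift_at; case: eqP => _; rewrite !mxE rmorphD /= /horner_eval hornerC.
  by rewrite hornerMn hornerX.
by rewrite horner0 addr0.
Qed.

(** The generic tuple is used, with its k-th matrix multiplied by an indeterminate, so that the
    coefficients of [Q] are again polynomial functions. *)
Lemma scale_at_poly k f :
  exists Q : {poly Fgl}, forall A l,
    f (scale_at k l A) = (map_poly (eval_at A) Q).[l].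
Proof.
have [Q QP] := coord_ring_eval (polyC \o in_alg Fgl)
  (fun j => (if j == k then 'X else 1) *: map_mx polyC (generic_mx F n j)) f.
exists Q => A l.
rewrite -[RHS]/((horner_eval l \o map_poly (eval_at A)) Q) -QP; last first.
  move=> c; rewrite /= map_polyC /horner_eval hornerC /eval_at.
  exact: mulr1.
congr (cfun f _); apply: funext => j; apply/matrixP => i m.
have genE :
    map_poly (eval_at A) (map_mx polyC (generic_mx F n j) i m) = (A j i m)%:P.
  by rewrite -(eval_generic_mx A j) [in LHS]mxE [in RHS]mxE map_polyC.
rewrite [RHS]mxE [X in _ = _ X]mxE rmorphM /= genE.
rewrite /scale_at; case: eqP => _.
  by rewrite [LHS]mxE map_polyX /horner_eval hornerX hornerC.
by rewrite rmorph1 /horner_eval !hornerC mul1r.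
Qed.

Lemma scale_at_comp k l m A : scale_at k l (scale_at k m A) = scale_at k (l * m) A.
Proof.
by apply: funext => j; rewrite /scale_at; case: eqP => // _; rewrite scalerA.
Qed.

Lemma scale_at1 k A : scale_at k 1 A = A.
Proof. by apply: funext => j; rewrite /scale_at scale1r if_same. Qed.

Lemma shift_at0 k A : shift_at k 0 A = A.
Proof. by apply: funext => j; rewrite /shift_at raddf0 addr0 if_same. Qed.

Lemma scale_at_conj k l (g : GL F n) A :
  scale_at k l (gl_conj g A) = gl_conj g (scale_at k l A).
Proof.
apply: funext => j; rewrite /scale_at /gl_conj; case: eqP => // _.
by rewrite -scalemxAr -scalemxAl.
Qed.

Lemma shift_at_conj k t (g : GL F n) A :
  shift_at k t (gl_conj g A) = gl_conj g (shift_at k t A).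
Proof.
apply: funext => j; rewrite /shift_at /gl_conj; case: eqP => // _.
rewrite mulmxDr mulmxDl; congr (_ + _).
by rewrite scalar_mxC -mulmxA mulmxV ?mulmx1 // gl_mxP.
Qed.

(** The components are the coefficients of f(lA) in l. Setting l = 1 gives the sum, rescaling twice
    gives homogeneity, and invariance follows because rescaling commutes with conjugation. *)
Lemma homog_decomp k f :
  exists Q : {poly Fgl}, [/\
    forall A, f A = \sum_(d < size Q) Q`_d A,
    forall d l A, Q`_d (scale_at k l A) = l ^+ d * Q`_d A
  & forall g : GL F n, (forall A, f (gl_conj g A) = f A) ->
      forall d A, Q`_d (gl_conj g A) = Q`_d A].
Proof.
have [Q fQ] := scale_at_poly k f; exists Q; pose q A := map_poly (eval_at A) Q.
have qE A d : (q A)`_d = Q`_d A by rewrite coef_map.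
split=> [A|d l A|g fg d A].
- rewrite -{1}[A](scale_at1 k) fQ (horner_coef_wide _ (size_poly _ _)).
  by apply: eq_bigr => d _; rewrite -/(q A) qE expr1n mulr1.
- rewrite -!qE.
  have -> : q (scale_at k l A) = \poly_(i < size (q A)) (l ^+ i * (q A)`_i).
    apply: (@poly_fun_inj F) => x.
    rewrite -fQ scale_at_comp fQ -/(q A) [RHS]horner_poly horner_coef.
    apply: eq_bigr => i _.
    by rewrite exprMn [x ^+ i * _]mulrC mulrA [_ * l ^+ i]mulrC.
  by rewrite coef_poly; case: ltnP => // ?; rewrite nth_default ?mulr0.
- rewrite -!qE; suff -> : q (gl_conj g A) = q A by [].
  apply: poly_fun_inj => x; by rewrite -!fQ scale_at_conj fg.
Qed.

Lemma det_scale_at k l A : \det (scale_at k l A k) = l ^+ n * \det (A k).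
Proof. by rewrite /scale_at eqxx detZ. Qed.

(** [V] will express determinant conditions on other matrices. The [h d] are plain functions, so
    that differences between a component and its conjugate fit as well. *)
Lemma homog_extend k D (h : nat -> glr F n r -> F) (V : glr F n r -> Prop) :
    (0 < n)%N ->
    (forall d l A, h d (scale_at k l A) = l ^+ d * h d A) ->
    (forall d A, exists u : {poly F}, forall t, h d (shift_at k t A) = u.[t]) ->
    (forall l A, V A -> V (scale_at k l A)) ->
    (forall t A, V A -> V (shift_at k t A)) ->
    (forall A, V A -> \det (A k) = 1 -> \sum_(d < D) h d A = 0) ->
  forall A, V A -> \sum_(d < D) h d A * \det (A k) ^+ ((D - d) %/ n) = 0.
Proof.
move=> n0 hZ hS VZ VS h0.
have unit_det A : V A -> \det (A k) != 0 ->
    \sum_(d < D) h d A * \det (A k) ^+ ((D - d) %/ n) = 0.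
  move=> VA dA; pose l := n.-root (\det (A k)).
  have ln : l ^+ n = \det (A k) by rewrite rootCK.
  have l0 : l != 0 by apply: contra_neq dA => l0; rewrite -ln l0 expr0n gtn_eqF.
  have [B VB [dB BA]] : exists2 B, V B & \det (B k) = 1 /\ A = scale_at k l B.
    exists (scale_at k l^-1 A); first exact: VZ.
    by rewrite det_scale_at exprVn ln mulVf // scale_at_comp mulfV // scale_at1.
  (* Reducing the exponents D - d modulo n preserves values at n-th roots of unity and brings the
     degree below n. *)
  pose Q : {poly F} := \sum_(d < D) h d B *: 'X^((D - d) %% n).
  have QE z : Q.[z] = \sum_(d < D) h d B * z ^+ ((D - d) %% n).
    by rewrite horner_sum; apply: eq_bigr => d _; rewrite !hornerE.
  have szQ : (size Q <= n)%N.
    apply: (leq_trans (size_sum _ _ _)); apply/bigmax_leqP => d _.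
    by rewrite (leq_trans (size_scale_leq _ _)) // size_polyXn ltn_mod.
  have Q0 : Q = 0.
    apply: (unity_roots_eq0 n0 szQ) => z zn.
    have z0 : z != 0 by rewrite -unitfE -(unitrX_pos _ n0) zn unitr1.
    rewrite QE; transitivity (z ^+ D * \sum_(d < D) h d (scale_at k z^-1 B)).
      rewrite mulr_sumr; apply: eq_bigr => d _.
      rewrite hZ expr_mod // mulrA exprVn.
      rewrite -expfB_cond ?(negPf z0) ?(ltnW (ltn_ord d)) //.
      by rewrite mulrC.
    by rewrite h0 ?mulr0 ?det_scale_at ?exprVn ?zn ?invr1 ?mul1r //; apply: VZ.
  (* Since det(A_k) = l^n, the term of index d scales by l to the power D - ((D - d) mod n). *)
  transitivity (l ^+ D * Q.[l^-1]); last by rewrite Q0 horner0 mulr0.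
  rewrite QE mulr_sumr; apply: eq_bigr => d _.
  rewrite -ln -exprM {1}BA hZ [in RHS]mulrCA mulrAC -exprD mulrC; congr (_ * _).
  have -> : l ^+ D = l ^+ (d + n * ((D - d) %/ n)) * l ^+ ((D - d) %% n).
    by rewrite -exprD -addnA mulnC -divn_eq subnKC // ltnW.
  by rewrite exprVn mulfK // expf_neq0.
(* If A k is singular: the identity holds at all but finitely many points of
   the line t |-> A k + t I, on which it is polynomial. *)
move=> A VA.
have [u uP] := boolp.choice (fun d => hS d A).
(* This is det(A_k + tI), monic in t and hence nonzero. *)
pose c := char_poly (- A k).
have cE t : c.[t] = \det (shift_at k t A k).
  rewrite /c /char_poly -[LHS]/(horner_eval t _) -det_map_mx /shift_at eqxx.
  congr (\det _); apply/matrixP => i j.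
  rewrite !mxE raddfN opprK rmorphD rmorphMn /=.
  by rewrite /horner_eval hornerX hornerC addrC.
pose w := \sum_(d < D) u d * c ^+ ((D - d) %/ n).
have wE t : w.[t] =
    \sum_(d < D) h d (shift_at k t A) * \det (shift_at k t A k) ^+ ((D - d) %/ n).
  by rewrite horner_sum; apply: eq_bigr => d _; rewrite !hornerE uP cE.
have /eqP : w * c = 0.
  apply: poly_fun_eq0 => t; rewrite hornerM wE cE.
  have [->|dt] := eqVneq (\det (shift_at k t A k)) 0.
    by rewrite mulr0.
  by rewrite unit_det ?mul0r //; apply: VS.
rewrite mulf_eq0 (negPf (monic_neq0 (char_poly_monic _))) orbF => /eqP w0.
by have := wE 0; rewrite w0 horner0 shift_at0 => <-.
Qed.
End Rescaling.

(** * Normalization modulo the functions det(X_k) - 1 *)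

Section Normalization.
Variables (F : numClosedFieldType) (n r : nat).
Hypothesis n0 : (0 < n)%N.
Local Notation Fgl := (coord_ring (@glr_mx F n r)).
Implicit Types (A : glr F n r) (f : Fgl) (k : 'I_r).

Let detg k : Fgl := \det (generic_mx F n k).

Lemma det_generic k A : detg k A = \det (A k).
Proof. by rewrite -[LHS]/(eval_at A _) -det_map_mx eval_generic_mx. Qed.

Lemma coord_ringP (f f' : Fgl) : (forall A, f A = f' A) -> f = f'.
Proof. by move=> ff'; apply/val_inj/funext. Qed.

(** The last clause leaves [V] arbitrary, so that the step can be iterated while other matrices
    still carry their constraints. *)
Lemma det_adjoin_step k f :
  exists f' c : Fgl, [/\
    f' = f + c * (detg k - 1),
    forall g : GL F n, (forall A, f (gl_conj g A) = f A) ->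
      forall A, c (gl_conj g A) = c A
  & forall V : glr F n r -> Prop,
      (forall l A, V A -> V (scale_at k l A)) ->
      (forall t A, V A -> V (shift_at k t A)) ->
      ((forall A, V A -> \det (A k) = 1 -> f A = 0) -> forall A, V A -> f' A = 0)
      /\ (forall g : GL F n,
        (forall A, V A -> \det (A k) = 1 -> f (gl_conj g A) = f A) ->
        forall A, V A -> f' (gl_conj g A) = f' A)].
Proof.
have [Q [fQ QZ Qg]] := homog_decomp k f.
pose e d := ((size Q - d) %/ n)%N.
pose f' := \sum_(d < size Q) Q`_d * detg k ^+ e d.
have f'E A : f' A = \sum_(d < size Q) Q`_d A * \det (A k) ^+ e d.
  rewrite -[LHS]/(eval_at A _) rmorph_sum; apply: eq_bigr => d _.
  by rewrite rmorphM rmorphXn /= {2}/eval_at det_generic.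
(* The inner sum comes from x^e - 1 = (x - 1)(1 + ... + x^(e-1)). *)
pose c := \sum_(d < size Q) Q`_d * \sum_(i < e d) detg k ^+ i.
have cE A : c A = \sum_(d < size Q) Q`_d A * \sum_(i < e d) \det (A k) ^+ i.
  rewrite -[LHS]/(eval_at A _) rmorph_sum; apply: eq_bigr => d _.
  rewrite rmorphM rmorph_sum; congr (_ * _); apply: eq_bigr => i _.
  by rewrite rmorphXn /= /eval_at det_generic.
have det_conj g A : \det (gl_conj g A k) = \det (A k).
  rewrite /gl_conj !det_mulmx det_inv mulrAC divrr ?mul1r //.
  by rewrite -unitmxE gl_mxP.
exists f', c; split.
- have -> : f = \sum_(d < size Q) Q`_d.
    apply: coord_ringP => A; rewrite fQ -[RHS]/(eval_at A _) rmorph_sum.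
    by [].
  rewrite mulr_suml -big_split; apply: eq_bigr => d _ /=.
  by rewrite -mulrA [_ * (detg k - 1)]mulrC -subrX1 mulrBr mulr1 addrC subrK.
- move=> g fg A; rewrite !cE; apply: eq_bigr => d _.
  by rewrite Qg // det_conj.
move=> V VZ VS; split=> [f0 A VA|g fg A VA].
  rewrite f'E; apply: (homog_extend (V := V) (h := fun d A => Q`_d A)) => //.
    by move=> d B; apply: shift_at_poly.
  by move=> B VB dB; rewrite -fQ f0.
apply/eqP; rewrite -subr_eq0 !f'E -sumrB; apply/eqP.
under eq_bigr => d _ do rewrite det_conj -mulrBl.
(* Determinants are invariant under conjugation, so f'(gA) - f'(A) has the same shape, with
   differences of components. *)
apply: (homog_extend (V := V) (h := fun d A => Q`_d (gl_conj g A) - Q`_d A)) => //.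
- by move=> d l B; rewrite -scale_at_conj !QZ mulrBr.
- move=> d B; have [u uP] := shift_at_poly k (gl_conj g B) Q`_d.
  have [v vP] := shift_at_poly k B Q`_d; exists (u - v) => t.
  by rewrite -shift_at_conj uP vP hornerD hornerN.
by move=> B VB dB; rewrite sumrB -!fQ fg ?subrr.
Qed.

Lemma det_adjoin f :
  exists (f' : Fgl) (c : 'I_r -> Fgl), [/\
    f' = f + \sum_k c k * (detg k - 1),
    forall g : GL F n, (forall A, f (gl_conj g A) = f A) ->
      forall k A, c k (gl_conj g A) = c k A,
    (forall A, (forall k, \det (A k) = 1) -> f A = 0) -> f' = 0
  & forall g : GL F n,
      (forall A, (forall k, \det (A k) = 1) -> f (gl_conj g A) = f A) ->
      forall A, f' (gl_conj g A) = f' A].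
Proof.
(* Constraints are released from the last index to the first: after m steps only the first r - m
   determinants must be 1. *)
pose V j A := forall i : 'I_r, (i < j)%N -> \det (A i) = 1.
(* The claim also records invariance of [f'], needed for the next correction coefficient to be
   invariant. *)
suff /(_ r (leqnn r)) : forall m, (m <= r)%N ->
  exists (f' : Fgl) (c : 'I_r -> Fgl), [/\
    f' = f + \sum_k c k * (detg k - 1),
    forall g : GL F n, (forall A, f (gl_conj g A) = f A) ->
      (forall A, f' (gl_conj g A) = f' A) /\ forall k A, c k (gl_conj g A) = c k A,
    (forall A, (forall k, \det (A k) = 1) -> f A = 0) ->
      forall A, V (r - m)%N A -> f' A = 0
  & forall g : GL F n,
      (forall A, (forall k, \det (A k) = 1) -> f (gl_conj g A) = f A) ->
      forall A, V (r - m)%N A -> f' (gl_conj g A) = f' A].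
  move=> [f' [c [f'E cP f'0 f'P]]]; rewrite subnn in f'0 f'P.
  exists f', c; split=> //.
  - by move=> g /cP[].
  - by move=> /f'0 f'V; apply: coord_ringP => A; apply: f'V.
  - by move=> g /f'P f'V A; apply: f'V.
elim=> [_|m IHm lt_mr].
  exists f, (fun=> 0); split=> //.
  - by rewrite big1 ?addr0 // => k _; rewrite mul0r.
  - by move=> f0 A VA; apply: f0 => k; apply: VA; rewrite subn0.
  - by move=> g fg A VA; apply: fg => k; apply: VA; rewrite subn0.
have [f1 [c1 [f1E c1P f10 f1P]]] := IHm (ltnW lt_mr).
have lt_k : (r - m.+1 < r)%N by rewrite ltn_subrL (leq_ltn_trans _ lt_mr).
(* The last index still constrained; the remaining conditions concern smaller indices, so changing
   the k-th matrix preserves them. *)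
pose k := Ordinal lt_k.
have [f' [c [f'E cP f'V]]] := det_adjoin_step k f1.
have VZ l A : V (r - m.+1)%N A -> V (r - m.+1)%N (scale_at k l A).
  by move=> VA i ik; rewrite /scale_at ifN ?VA // -val_eqE ltn_eqF.
have VS t A : V (r - m.+1)%N A -> V (r - m.+1)%N (shift_at k t A).
  by move=> VA i ik; rewrite /shift_at ifN ?VA // -val_eqE ltn_eqF.
have V1 A : V (r - m.+1)%N A -> \det (A k) = 1 -> V (r - m)%N A.
  move=> VA dA i; rewrite -subnSK // ltnS leq_eqVlt.
  case/orP => [/eqP ik|]; last exact: VA.
  by rewrite (_ : i = k) //; apply: val_inj.
exists f', (fun j => c1 j + if j == k then c else 0); split.
- rewrite f'E f1E -addrA; congr (_ + _); under [RHS]eq_bigr do rewrite mulrDl.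
  rewrite big_split /=; congr (_ + _); rewrite (bigD1 k) //= eqxx big1 ?addr0 //.
  by move=> j /negPf->; rewrite mul0r.
- move=> g fg; have [f1g c1g] := c1P g fg; split.
    move=> A; apply: (f'V (fun=> True) (fun _ _ _ => I) (fun _ _ _ => I)).2 => //.
  move=> j A; rewrite -![(_ + _ : Fgl) _]/(eval_at _ _) !rmorphD /= /eval_at c1g.
  by case: eqP => // _; rewrite cP.
- by move=> f0; apply: (f'V _ VZ VS).1 => A VA dA; apply: f10 => //; apply: V1.
- by move=> g fg; apply: (f'V _ VZ VS).2 => A VA dA; apply: f1P => //; apply: V1.
Qed.
End Normalization.

(** * Restriction to SL and the isomorphism *)

Section Isomorphism.
Local Open Scope quotient_scope.
Variables (F : numClosedFieldType) (n r : nat).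
Hypothesis n0 : (0 < n)%N.
Local Notation Igl := (gl_inv F n r).
Local Notation Isl := (sl_inv F n r).

Let ev (A : glr F n r) : {rmorphism Igl -> F} := eval_at A \o val.

Lemma sl_mx_unit (g : SL F n) : sl_mx g \in unitmx.
Proof. by rewrite unitmxE sl_mxP unitr1. Qed.

Lemma slr_tuple (A : glr F n r) : (forall k, \det (A k) = 1) ->
  exists B : slr F n r, slr_mx B = A.
Proof. by move=> dA; exists (fun k => MkSL (dA k)); apply: funext. Qed.

(** Dividing g by an n-th root of its determinant does not change conjugation by g. *)
Lemma gl_conj_sl (g : GL F n) :
  exists h : SL F n, forall A : glr F n r,
    gl_conj g A = gl_conj (MkGL (sl_mx_unit h)) A.
Proof.
pose l := n.-root (\det g).
have ln : l ^+ n = \det g by rewrite rootCK.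
have dg0 : \det g != 0 by have := gl_mxP g; rewrite unitmxE unitfE.
have l0 : l != 0 by apply: contra_neq dg0 => l0; rewrite -ln l0 expr0n gtn_eqF.
have dh : \det (l^-1 *: gl_mx g) = 1 by rewrite detZ exprVn ln mulVf.
exists (MkSL dh) => A; apply: funext => k; rewrite /gl_conj /=.
rewrite invmxZ ?(sl_mx_unit (MkSL dh)) //.
rewrite -?scalemxAl -?scalemxAr ?scalemxAl ?scalerA.
by rewrite mulfV ?invr_neq0 // scale1r.
Qed.

(** The ideal is the kernel of restriction: if x vanishes on SL tuples, its normalization is 0,
    which writes x through the det(X_k) - 1 with invariant coefficients. *)
Lemma rel_idealE (x : Igl) :
  x \in @rel_ideal F n r <-> forall A : slr F n r, inv_fun x (slr_mx A) = 0.
Proof.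
split=> [/asboolP[c ->] A|x0].
  rewrite -[LHS]/(ev (slr_mx A) (\sum_k c k * rel_gen F n k)) rmorph_sum.
  rewrite big1 // => k _.
  rewrite rmorphM [X in _ * X]eval_rel_fun /slr_mx sl_mxP subrr mulr0 oppr0.
  by rewrite mulr0.
have [f' [c [f'E cP f'0 _]]] := det_adjoin n0 (inv_fun x).
have /asboolP xP := inv_funP x.
have cI k : c k \in invariant_pred (@gl_conj F n r).
  by apply/asboolP => g A; apply: cP.
(* The k-th generator is -(-1)^n n (det(X_k) - 1), and n is invertible in characteristic zero. *)
pose a : F := ((-1) ^+ n * n%:R)^-1.
apply/asboolP; exists (fun k => a *: InvariantRing (cI k)); apply: val_inj.
apply: coord_ringP => A.
have := congr1 (eval_at A) f'E; rewrite f'0; last first.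
  by move=> B /slr_tuple[C <-]; apply: x0.
rewrite rmorph0 rmorphD => /esym/eqP; rewrite addr_eq0 => /eqP xE.
rewrite -[LHS]/(eval_at A _) xE rmorph_sum -[RHS]/(ev A _).
rewrite rmorph_sum -sumrN; apply: eq_bigr => k _.
rewrite -scalerAl -[RHS]/(a * (eval_at A (c k) * eval_at A (rel_fun F n k))).
rewrite eval_rel_fun rmorphM rmorphB rmorph1 [X in _ * (X - 1)]det_generic.
rewrite !mulrN mulrCA [a * _]mulrA mulVf ?mul1r //.
by rewrite mulf_neq0 ?signr_eq0 // pnatr_eq0 -lt0n.
Qed.

(** A polynomial extension of y is known to be invariant only on SL tuples; normalizing keeps its
    values there and makes it invariant everywhere. *)
Lemma sl_inv_lift (y : Isl) :
  exists x : Igl, forall A : slr F n r, inv_fun x (slr_mx A) = inv_fun y A.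
Proof.
have /asboolP[p yp] := cfunP (inv_fun y).
have fP : (fun A : glr F n r => p.@[coords A] : F^o)
    \in polyfun_pred (@glr_mx F n r).
  by apply/asboolP; exists p.
have [f' [c [f'E _ _ f'P]]] := det_adjoin n0 (CoordRing fP).
have f'res A : f' (slr_mx A) = inv_fun y A.
  rewrite -[LHS]/(eval_at _ f') f'E rmorphD rmorph_sum big1 ?addr0 => [|k _].
    by rewrite yp.
  rewrite rmorphM rmorphB rmorph1 [X in _ * (X - 1)]det_generic /slr_mx sl_mxP.
  by rewrite subrr mulr0.
have f'I : f' \in invariant_pred (@gl_conj F n r).
  (* Invariance of y is known under SL only, so g is replaced by an element of SL acting alike. *)
  apply/asboolP => g A; have [h ->] := gl_conj_sl g.
  apply: f'P => B /slr_tuple[C <-] /=.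
  have /asboolP yP := inv_funP y.
  rewrite -[RHS]yp -(yP h) yp; congr (p.@[coords _]).
by exists (InvariantRing f'I).
Qed.

Lemma gl_inv_restrict (x : Igl) :
  exists y : Isl, forall A : slr F n r, inv_fun y A = inv_fun x (slr_mx A).
Proof.
have /asboolP[p xp] := cfunP (inv_fun x).
have fP : (fun A : slr F n r => inv_fun x (slr_mx A))
    \in polyfun_pred (@slr_mx F n r).
  by apply/asboolP; exists p => A; rewrite xp.
have yI : CoordRing fP \in invariant_pred (@sl_conj F n r).
  apply/asboolP => g A /=; have /asboolP xP := inv_funP x.
  exact: (xP (MkGL (sl_mx_unit g)) (slr_mx A)).
by exists (InvariantRing yI).
Qed.

(** Lifts are picked by choice, yet their classes form a morphism, because two invariants have the
    same class exactly when they agree on SL tuples. The inverse restricts a representative. *)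
Lemma sl_gl_iso :
  exists phi : {lrmorphism Isl -> {ideal_quot @rel_ideal F n r}}, bijective phi.
Proof.
have [L LP] := boolp.choice sl_inv_lift.
have [S SP] := boolp.choice gl_inv_restrict.
pose Q := {ideal_quot @rel_ideal F n r}.
have evE (z : Igl) A : inv_fun z A = ev A z by [].
have piE (x x' : Igl) : (forall A, inv_fun x (slr_mx A) = inv_fun x' (slr_mx A)) ->
    \pi_Q x = \pi_Q x'.
  move=> xx'; have relB : x - x' \in @rel_ideal F n r.
    apply/rel_idealE => A; rewrite evE rmorphB.
    apply/eqP; rewrite subr_eq0; exact/eqP/xx'.
  by apply/eqP; rewrite -Quotient.idealrBE.
have piE' (x x' : Igl) : \pi_Q x = \pi_Q x' ->
    forall A, inv_fun x (slr_mx A) = inv_fun x' (slr_mx A).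
  move=> xx'; have /rel_idealE xx'0 : x - x' \in @rel_ideal F n r.
    by rewrite Quotient.idealrBE; apply/eqP.
  move=> A; apply: subr0_eq; have := xx'0 A.
  by rewrite evE rmorphB.
pose phi y : Q := \pi_Q (L y).
have phiB : zmod_morphism phi.
  move=> y z; rewrite /phi -rmorphB; apply: piE => A.
  by rewrite LP [RHS]evE rmorphB -!evE !LP.
have phiM : monoid_morphism phi.
  split=> [|y z]; rewrite /phi.
    by rewrite -(rmorph1 (\pi_Q)); apply: piE => A; rewrite LP [RHS]evE rmorph1.
  rewrite -rmorphM; apply: piE => A.
  by rewrite LP [RHS]evE rmorphM -!evE !LP.
have phiZ : scalable phi.
  move=> a y; rewrite /phi -[RHS]pi_scale; apply: piE => A.
  rewrite LP -[RHS]/(a * inv_fun (L y) (slr_mx A)).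
  by rewrite LP.
pose phi1 := GRing.isZmodMorphism.Build _ _ phi phiB.
pose phi2 := GRing.isMonoidMorphism.Build _ _ phi phiM.
pose phi3 := GRing.isScalable.Build _ _ _ _ phi phiZ.
pose phi' : {lrmorphism Isl -> Q} := HB.pack phi phi1 phi2 phi3.
exists phi'; exists (fun q => S (repr q)) => [y|q] /=.
  apply/val_inj/val_inj/funext => A; rewrite [LHS]SP -[RHS]LP.
  by apply: piE'; rewrite reprK.
by rewrite -[RHS]reprK; apply: piE => A; rewrite LP SP.
Qed.
End Isomorphism.

Theorem proposition13 (R : realType) (n r : nat) (n_gt0 : (0 < n)%N)
    (r_gt0 : (0 < r)%N) :
  [/\ exists phi : {lrmorphism sl_inv R[i] n r ->
                      {ideal_quot @rel_ideal R[i] n r}}, bijective phi,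
      forall k : 'I_r, let X := generic_mx R[i] n k in
        Ppoly X = (-1) ^+ n.+1 * n%:R
          + \sum_(1 <= j < n) (-1) ^+ (n + j + 1) * C0 X (n - j) * \tr (X ^+ j),
      exists Q : {mpoly R[i][n.+1]}, forall k : 'I_r,
        let X := generic_mx R[i] n k in
        Ppoly X = mmap (in_alg _) (fun j : 'I_n.+1 => Ccoef X j) Q
    & forall k : 'I_r, let X := generic_mx R[i] n k in
        [/\ C0 X 0 = 1, C0 X 1 = \tr X
          & forall m, (1 <= m <= n)%N ->
              C0 X m = m%:R^-1 *:
                \sum_(1 <= j < m.+1) (-1) ^+ (j + 1) * C0 X (m - j) * \tr (X ^+ j)]].
Proof.
split=> [|k X||k X].
- exact: sl_gl_iso.
- exact: PpolyE.
- exact: Ppoly_Ccoef.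
split=> [||m /andP[m_gt0 le_mn]]; [exact: C0_0 | exact: C0_1 |].
(* The sum is m C_0^m, and m > 0 is invertible among the scalars. *)
rewrite -newton_C0 // mulr_natl -scalerMnr scalerMnl -mulr_natr.
by rewrite mulVf ?scale1r // pnatr_eq0 -lt0n.
Qed.
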